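(* Let $a\leqslant b$ be two positive integers. Let $G=(X,Y)$ be a bipartite graph with parts $X,Y$, $|X|\leqslant |Y|$, containing no $[a,b]$-factor. (i) If $a|Y|>b|X|$, then $\rho(G)\leqslant \sqrt{|X||Y|}$ with equality if and only if $G\cong K_{|X|,|Y|}$. (ii) If $a|Y|\leqslant b|X|$ and $a>|X|$, then $\rho(G)\leqslant \sqrt{|X||Y|}$ with equality if and only if $G\cong K_{|X|,|Y|}$. (iii) If $a|Y|\leqslant b|X|$ and $a\leqslant |X|$, then $\rho(G)\leqslant \rho(D(a-1,|X|-a+1;|Y|-1,1))$ with equality if and only if $G\cong D(a-1,|X|-a+1;|Y|-1,1)$.
   Context: For positive integers $a\leqslant b$, an $[a,b]$-factor of a graph $G$ is a spanning subgraph $F$ with $a\leqslant d_F(v)\leqslant b$ for all $v$. $\rho(G)$ is the adjacency spectral radius. For nonnegative integers $p_1,p_2,q_1,q_2$, $D(p_1,p_2;q_1,q_2)$ denotes the bipartite graph with parts $X=X_1\cup X_2$, $Y=Y_1\cup Y_2$ (disjoint), $|X_i|=p_i$, $|Y_i|=q_i$, in which every vertex of $X_1$ is adjacent to every vertex of $Y_1\cup Y_2$, every vertex of $X_2$ is adjacent to every vertex of $Y_1$, and there are no other edges. *)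

(* Defs.v *)
From HB Require Import structures.
From mathcomp Require Import all_boot all_order all_algebra.
From mathcomp Require Import all_classical all_reals.
From mathcomp Require Import complex.

Set Implicit Arguments.
Unset Strict Implicit.
Unset Printing Implicit Defensive.

Import Order.TTheory GRing.Theory Num.Theory.

Record sgraph := SGraph {
  vertex :> finType;
  adj : rel vertex;
  adj_sym : symmetric adj;
  adj_irrefl : irreflexive adj
}.

Definition giso (G H : sgraph) : Prop :=
  exists2 f : G -> H, bijective f & forall u v, adj (f u) (f v) = adj u v.

(* The parts are allowed to be empty. *)
Definition bipartition (G : sgraph) (X Y : {set G}) : Prop :=
  [/\ X :|: Y = [set: G], [disjoint X & Y] &
      forall u v : G, adj u v ->
        (u \in X) && (v \in Y) || (u \in Y) && (v \in X)].

(* A spanning subgraph of G is a symmetric F contained in adj; irreflexivity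
   of F is inherited from adj. *)
Definition has_factor (a b : nat) (G : sgraph) : Prop :=
  exists F : rel G,
    [/\ symmetric F, subrel F (@adj G) &
        forall v : G, a <= #|[set u | F v u]| <= b].

Section BipartiteGraph.
Variables (S T : finType) (e : S -> T -> bool).

Definition bip_adj : rel (S + T) := fun u v =>
  match u, v with
  | inl x, inr y => e x y
  | inr y, inl x => e x y
  | _, _ => false
  end.

Lemma bip_adj_sym : symmetric bip_adj.
Proof. by case=> [x|y] [x'|y']. Qed.

Lemma bip_adj_irrefl : irreflexive bip_adj.
Proof. by case. Qed.

Definition bip_graph := SGraph bip_adj_sym bip_adj_irrefl.

End BipartiteGraph.

Definition Kgraph (m n : nat) : sgraph :=
  bip_graph (fun (_ : 'I_m) (_ : 'I_n) => true).

Definition Dgraph (p1 p2 q1 q2 : nat) : sgraph :=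
  bip_graph (fun (x : 'I_p1 + 'I_p2) (y : 'I_q1 + 'I_q2) =>
    match x, y with
    | inl _, _ => true
    | inr _, inl _ => true
    | inr _, inr _ => false
    end).

Local Open Scope ring_scope.
Local Open Scope classical_set_scope.
Local Open Scope complex_scope.

Definition adjmx (R : realType) (G : sgraph) : 'M[R[i]]_#|G| :=
  \matrix_(i, j) (adj (enum_val i) (enum_val j))%:R.

(* [`|z|] is the modulus viewed as an element of R[i], so its real part is the
   modulus in R. The set is finite, and nonempty when n > 0, so the supremum is
   then a maximum; for n = 0 it is 0. *)
Definition spectral_radius (R : realType) (n : nat) (A : 'M[R[i]]_n) : R :=
  sup [set complex.Re `|z| | z in [set z : R[i] | eigenvalue A z]].

Definition rho (R : realType) (G : sgraph) : R :=
  spectral_radius (adjmx R G).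
Arguments rho : clear implicits.

(* Main.v *)
Require Import Defs.
From HB Require Import structures.
From mathcomp Require Import all_boot all_order all_algebra.
From mathcomp Require Import all_classical all_reals.
From mathcomp Require Import complex ring lra zify.

Set Implicit Arguments.
Unset Strict Implicit.
Unset Printing Implicit Defensive.

Import Order.TTheory GRing.Theory Num.Theory.

(** Write [m = |X|], [n = |Y|], and let [K] be the number of pairs in [X * Y]
that are not edges.

If [K <= m - a] (in case (iii)) there is an [[a,b]]-factor: among the subgraphs
in which every vertex of [Y] has degree exactly [a], take one minimizing the sum
of the squared degrees on [X].  A vertex of [X] of degree above [b] or below [a]
would, by following alternating paths, yield a set whose edge count forces more
than [m - a] missing pairs.  Hence [K >= k := m - a + 1].

For the spectral part, let [(x, y)] be a nonnegative eigenvector for [rho], put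
[l = rho ^ 2] and [s = sum x], and let [c_j] count the missing pairs in column
[j].  Summing the equations of [B B^T x = l x] gives
[l s = (m n - K) s - sum_(ij missing) (m - c_j) x_i], and for a missing [ij]
comparing coefficients gives [l x_i >= (n - 1 - (K - c_j)) s].  As
[(m - c_j) (n - 1 - (K - c_j)) >= (m - K) (n - 1)], this yields
[l (m n - K - l) >= K (m - K) (n - 1)], so [l] is at most the larger root of the
quadratic satisfied by [rho ^ 2] of [D(m - k, k; n - 1, 1)]. *)

(** * Nonnegative eigenvectors for the spectral radius *)

Section NormalMatrix.
Local Open Scope ring_scope.
Local Open Scope sesquilinear_scope.
Variables (C : numClosedFieldType) (n : nat).
Implicit Types (A : 'M[C]_n) (v : 'rV[C]_n).

Lemma mulmx_trmxC_sum v : (v *m v^t*) 0 0 = \sum_i `|v 0 i| ^+ 2.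
Proof. by rewrite mxE; apply: eq_bigr => i _; rewrite !mxE normCK. Qed.

Lemma spectral_diag_eigenvalue A i :
  A \is normalmx -> eigenvalue A (spectral_diag A 0 i).
Proof.
move=> /orthomx_spectralP nA; apply/eigenvalueP.
exists (row i (spectralmx A)); last first.
  apply/eqP => P0; have := spectral_unit A; rewrite -row_free_unit.
  move=> /row_free_inj inj; have : delta_mx 0 i = 0 :> 'rV[C]_n.
    by apply: inj; rewrite -rowE P0 mul0mx.
  by move=> /matrixP /(_ 0 i); rewrite !mxE !eqxx => /eqP; rewrite oner_eq0.
rewrite {2}nA !mulmxA -row_mul mulmxV ?spectral_unit// row1 -rowE.
by apply/rowP => j; rewrite row_diag_mx -scalemxAl -rowE.
Qed.

(** In the orthonormal eigenbasis formed by the rows of [spectralmx A], applying [A] multiplies each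
    coordinate of [v] by an eigenvalue, whose modulus is at most [r]. *)
Lemma normal_norm_le A (r : C) v :
  A \is normalmx -> (forall z, eigenvalue A z -> `|z| <= r) ->
  \sum_i `|(v *m A) 0 i| ^+ 2 <= r ^+ 2 * \sum_i `|v 0 i| ^+ 2.
Proof.
move=> nA Ar; have /orthomx_spectralP eA := nA.
have uP := spectral_unitarymx A; move: eA; rewrite invmx_unitary//.
set P := spectralmx A in uP *; set d := spectral_diag A => eA.
set u := v *m P^t*.
have vE : v *m A = u *m diag_mx d *m P by rewrite {1}eA !mulmxA.
have vu : v = u *m P by rewrite -mulmxA -invmx_unitary// mulVmx ?spectral_unit ?mulmx1.
have normP (w : 'rV_n) : (w *m P *m (w *m P)^t*) 0 0 = (w *m w^t*) 0 0.
  by rewrite trmx_mul map_mxM !mulmxA mulmxtVK.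
rewrite -!mulmx_trmxC_sum vE vu !normP !mulmx_trmxC_sum.
rewrite mulr_sumr; apply: ler_sum => i _.
rewrite mul_mx_diag mxE normrM exprMn mulrC ler_wpM2r ?exprn_ge0//.
by rewrite lerXn2r ?nnegrE//; [apply: le_trans (Ar _ (spectral_diag_eigenvalue i nA))
  |apply: Ar; exact: spectral_diag_eigenvalue].
Qed.

End NormalMatrix.

Section Perron.
Local Open Scope ring_scope.
Local Open Scope complex_scope.
Variables (R : realType) (G : sgraph).
Implicit Types (z : R[i]) (w : G -> R).

Lemma adjmx_normal : adjmx R G \is normalmx.
Proof.
apply: symmetric_normalmx.
  apply/is_hermitianmxP; rewrite expr0 scale1r; apply/matrixP => i j.
  by rewrite !mxE adj_sym.
by apply/mxOverP => i j; rewrite mxE realn.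
Qed.

Lemma Re_normE z : (complex.Re `|z|)%:C = `|z|.
Proof. by case: z. Qed.

Lemma sqr_norm_real_complex (r : R) : `|r%:C| ^+ 2 = (r ^+ 2)%:C.
Proof.
by rewrite normc_def/= expr0n addr0 sqrtr_sqr -rmorphXn/= real_normK ?num_real.
Qed.

Lemma Re_norm_ge0 z : 0 <= complex.Re `|z|.
Proof. by rewrite -lecR Re_normE normr_ge0. Qed.

(** The characteristic polynomial splits over [R[i]], so the eigenvalues form a finite nonempty list
    and the supremum is attained. *)
Lemma spectral_radius_max n (A : 'M[R[i]]_n) : (0 < n)%N ->
  (exists2 z, eigenvalue A z & complex.Re `|z| = spectral_radius A) /\
  (forall z, eigenvalue A z -> complex.Re `|z| <= spectral_radius A).
Proof.
move=> n0; have [rs Ars] := closed_field_poly_normal (char_poly A).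
have mon : lead_coef (char_poly A) = 1 by apply/monicP; exact: char_poly_monic.
have memP z : eigenvalue A z = (z \in rs).
  by rewrite eigenvalue_root_char Ars mon scale1r root_prod_XsubC.
have [z0 z0A] := eigenvalue_closed A n0.
have z0rs : z0 \in rs by rewrite -memP.
pose i0 : seq_sub rs := SeqSub z0rs.
pose zm := [arg max_(i > i0) complex.Re `|ssval i|]%O.
have zmax z : eigenvalue A z -> complex.Re `|z| <= complex.Re `|ssval zm|.
  rewrite memP => zrs; rewrite /zm; case: arg_maxP => //= i _ /(_ (SeqSub zrs) isT).
  exact.
have zmA : eigenvalue A (ssval zm) by rewrite memP; exact: ssvalP.
have rE : spectral_radius A = complex.Re `|ssval zm|.
  apply/le_anti/andP; split.
    apply: ge_sup; first by exists (complex.Re `|ssval zm|), (ssval zm).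
    by move=> _ [z zA <-]; exact: zmax.
  apply: ub_le_sup; last by exists (ssval zm).
  by exists (complex.Re `|ssval zm|) => _ [z zA <-]; exact: zmax.
by split; [exists (ssval zm) | move=> z; rewrite rE; exact: zmax].
Qed.

Lemma sum_enum_val (F : G -> R) :
  \sum_v F v = \sum_(i < #|G|) F (enum_val i).
Proof. by rewrite (reindex (@enum_val _ G)) //; apply: onW_bij; exact: enum_val_bij. Qed.

(** Dimension 0 has no nonzero vector, so the supremum is over the empty set, where [sup] takes the
    value 0. *)
Lemma rho_void : #|G| = 0%N -> rho R G = 0.
Proof.
move=> G0; rewrite /rho /spectral_radius -[RHS](@sup0 R); congr sup.
apply/seteqP; split => // r -[z /eigenvalueP[v _ /eqP v0] _]; case: v0.
by apply/rowP => i; suff: (i < 0)%N by []; rewrite -G0.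
Qed.

(** All lower bounds on [rho] come from here, by exhibiting a real eigenvector. *)
Lemma rho_ge (r : R) w (u0 : G) : w u0 != 0 ->
  (forall u, \sum_v (adj u v)%:R * w v = r * w u) -> `|r| <= rho R G.
Proof.
move=> wu0 wr; have G0 : (0 < #|G|)%N by apply/card_gt0P; exists u0.
have [_ /(_ r%:C)] := spectral_radius_max (adjmx R G) G0.
rewrite normc_def/= expr0n addr0 sqrtr_sqr; apply.
apply/eigenvalueP; exists (\row_i (w (enum_val i))%:C); last first.
  apply/eqP => /rowP /(_ (enum_rank u0)); rewrite !mxE enum_rankK => /eqP.
  by rewrite eq_complex/= eqxx andbT (negPf wu0).
apply/rowP => j; rewrite !mxE -rmorphM -wr sum_enum_val rmorph_sum.
by apply: eq_bigr => i _; rewrite !mxE adj_sym rmorphM rmorph_nat mulrC.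
Qed.

Lemma rho_ge0 : 0 <= rho R G.
Proof.
have [/rho_void->//|/(spectral_radius_max (adjmx R G))[[z _ zr] _]] := posnP #|G|.
by rewrite /rho -zr; exact: Re_norm_ge0.
Qed.

(* The moduli [w] of an eigenvector for [rho] satisfy [rho w <= A w], and this
   is an equality because [A] is normal, so [|A w| <= rho |w|]. *)
Lemma perron : (0 < #|G|)%N -> exists w,
  [/\ forall u, 0 <= w u, exists u, w u != 0 &
      forall u, \sum_v (adj u v)%:R * w v = rho R G * w u].
Proof.
move=> G0; have [[z /eigenvalueP[v vz v0] zr] rmax] := spectral_radius_max (adjmx R G) G0.
rewrite -/(rho R G) in zr rmax.
pose w u := complex.Re `|v 0 (enum_rank u)|.
have w_ge0 u : 0 <= w u by exact: Re_norm_ge0.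
have wE i : (w (enum_val i))%:C = `|v 0 i| by rewrite Re_normE enum_valK.
exists w; split=> //.
  have /rV0Pn[i vi] := v0; exists (enum_val i).
  by apply: contraNneq vi => wi; rewrite -normr_eq0 -wE wi.
pose Aw u : R := \sum_v (adj u v)%:R * w v.
have Aw_ge u : rho R G * w u <= Aw u.
  rewrite -lecR rmorphM/= -zr !Re_normE -normrM.
  have /rowP /(_ (enum_rank u)) := vz; rewrite !mxE => <-.
  rewrite (le_trans (ler_norm_sum _ _ _))// /Aw sum_enum_val rmorph_sum.
  apply: ler_sum => i _; rewrite rmorphM/= wE normrM !mxE enum_rankK rmorph_nat.
  by rewrite adj_sym normr_nat mulrC.
have AwE i : ((\row_j (w (enum_val j))%:C) *m adjmx R G) 0 i = (Aw (enum_val i))%:C.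
  rewrite !mxE /Aw sum_enum_val rmorph_sum; apply: eq_bigr => j _.
  by rewrite !mxE adj_sym rmorphM rmorph_nat mulrC.
have Awsq : \sum_u Aw u ^+ 2 <= \sum_u (rho R G * w u) ^+ 2.
  rewrite -lecR.
  have := @normal_norm_le _ _ (adjmx R G) (rho R G)%:C (\row_j (w (enum_val j))%:C) adjmx_normal.
  have h x : eigenvalue (adjmx R G) x -> `|x| <= (rho R G)%:C.
    by move=> /rmax; rewrite -lecR Re_normE.
  move=> /(_ h); rewrite !sum_enum_val !rmorph_sum mulr_sumr.
  congr (_ <= _); apply: eq_bigr => i _.
    by rewrite AwE sqr_norm_real_complex.
  by rewrite mxE sqr_norm_real_complex exprMn [RHS]rmorphM/= !rmorphXn.
have sq_ge u : 0 <= Aw u ^+ 2 - (rho R G * w u) ^+ 2.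
  by rewrite subr_ge0 lerXn2r ?nnegrE ?Aw_ge ?mulr_ge0 ?rho_ge0// (le_trans _ (Aw_ge u)) ?mulr_ge0 ?rho_ge0.
have /eqP : \sum_u (Aw u ^+ 2 - (rho R G * w u) ^+ 2) = 0.
  by apply/le_anti; rewrite sumr_ge0// andbT sumrB subr_le0.
rewrite psumr_eq0// => /allP h u; have := h u (mem_index_enum u).
rewrite /= subr_eq0 eqrXn2 ?mulr_ge0 ?rho_ge0 ?(le_trans _ (Aw_ge u)) ?mulr_ge0 ?rho_ge0//.
by move=> /eqP.
Qed.

End Perron.

(** * Isomorphisms *)

Lemma giso_sym G H : giso G H -> giso H G.
Proof.
move=> [f [g fK gK] fadj]; exists g; first by exists f.
by move=> u v; rewrite -fadj !gK.
Qed.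

Lemma giso_trans G H K : giso G H -> giso H K -> giso G K.
Proof.
move=> [f fB fadj] [g gB gadj]; exists (g \o f); first exact: bij_comp.
by move=> u v; rewrite /= gadj fadj.
Qed.

Lemma giso_has_factor a b G H : giso G H -> has_factor a b G -> has_factor a b H.
Proof.
move=> [f [g fK gK] fadj] [F [symF subF degF]].
exists (fun u v => F (g u) (g v)); split=> [u v|u v /subF|v]; first exact: symF.
  by rewrite -fadj !gK.
rewrite (_ : [set u | F (g v) (g u)] = f @: [set u | F (g v) u]).
  by rewrite card_imset ?degF//; exact: can_inj fK.
apply/setP => u; rewrite inE; apply/idP/imsetP => [h|[u' + ->]].
  by exists (g u); rewrite ?inE ?gK.
by rewrite inE fK.
Qed.

(** Turning the two parts into finite types lets all later sums and counts range over whole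
    types. *)
Lemma giso_bip_graph_sub (G : sgraph) (X Y : {set G}) : bipartition X Y ->
  giso (bip_graph (fun (x : {x | x \in X}) (y : {y | y \in Y}) =>
          adj (val x) (val y))) G.
Proof.
move=> [XY dXY eXY].
have XnY x : x \in X -> x \in Y -> False.
  by move=> xX; rewrite (disjointFr dXY xX).
pose f (u : {x | x \in X} + {y | y \in Y}) : G :=
  match u with inl x => val x | inr y => val y end.
have f_inj : injective f.
  move=> [[x xX]|[y yY]] [[x' xX']|[y' yY']] /= exy.
  - by congr inl; exact: val_inj.
  - by case: (XnY x) => //; rewrite exy.
  - by case: (XnY y) => //; rewrite exy.
  - by congr inr; exact: val_inj.
exists f.
  apply: inj_card_bij => //; rewrite card_sum !card_sig -cardsT -XY cardsU.
  by rewrite (disjoint_setI0 dXY) cards0 subn0.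
move=> [[x xX]|[y yY]] [[x' xX']|[y' yY']] //=.
- by apply/negP => /eXY /orP[] /andP[] ? ?; [exact: (XnY x')|exact: (XnY x)].
- by rewrite adj_sym.
- by apply/negP => /eXY /orP[] /andP[] ? ?; [exact: (XnY y)|exact: (XnY y')].
Qed.

Lemma giso_bip_graph (S S' T T' : finType) (e : S -> T -> bool)
    (e' : S' -> T' -> bool) (f : S -> S') (g : T -> T') :
  bijective f -> bijective g -> (forall x y, e' (f x) (g y) = e x y) ->
  giso (bip_graph e) (bip_graph e').
Proof.
move=> [f' fK f'K] [g' gK g'K] fg.
exists (fun u => match u with inl x => inl (f x) | inr y => inr (g y) end).
  exists (fun u => match u with inl x => inl (f' x) | inr y => inr (g' y) end).
    by case=> [x|y]; rewrite ?fK ?gK.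
  by case=> [x|y]; rewrite ?f'K ?g'K.
by move=> [x|y] [x'|y'] /=.
Qed.

Lemma giso_bip_graph_swap (S T : finType) (e : S -> T -> bool) :
  giso (bip_graph e) (bip_graph (fun y x => e x y)).
Proof.
exists (fun u => match u with inl x => inr x | inr y => inl y end).
  by exists (fun u => match u with inl x => inr x | inr y => inl y end); case.
by move=> [x|y] [x'|y'].
Qed.

Lemma eq_card_bij (A B : finType) : #|A| = #|B| -> exists f : A -> B, bijective f.
Proof.
move=> AB; exists (fun x => enum_val (cast_ord AB (enum_rank x))).
exists (fun y => enum_val (cast_ord (esym AB) (enum_rank y))) => x;
by rewrite enum_valK ?cast_ordK ?cast_ordKV enum_rankK.
Qed.

Lemma bij_sum_of_pred (A : finType) (P : pred A) p q :
  #|[set x | P x]| = q -> #|A| = (p + q)%N ->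
  exists f : A -> 'I_p + 'I_q,
    bijective f /\ forall x, P x = if f x is inr _ then true else false.
Proof.
move=> Pq Apq.
have [f1 f1B] : exists f : 'I_p -> {x | ~~ P x}, bijective f.
  apply: eq_card_bij; rewrite card_sig card_ord.
  have := cardC P; rewrite Apq -Pq cardsE addnC => /addIn <-.
  by apply: eq_card => x; rewrite !inE.
have [f2 f2B] : exists f : 'I_q -> {x | P x}, bijective f.
  by apply: eq_card_bij; rewrite card_sig card_ord -Pq cardsE.
pose g (u : 'I_p + 'I_q) : A :=
  match u with inl i => val (f1 i) | inr j => val (f2 j) end.
have gP u : P (g u) = if u is inr _ then true else false.
  by case: u => [i|j] /=; [exact/negbTE/(valP (f1 i))|exact: (valP (f2 j))].
have g_inj : injective g.
  move=> u u' eu; have := congr1 P eu; rewrite !gP.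
  case: u u' eu => [i|j] [i'|j'] //= /val_inj eu _.
    by congr inl; exact: bij_inj eu.
  by congr inr; exact: bij_inj eu.
have [f gK fK] : bijective g.
  by apply: inj_card_bij => //; rewrite card_sum !card_ord Apq.
exists f; split; first by exists g.
by move=> x; rewrite -{1}(fK x) gP.
Qed.

Lemma giso_Kgraph (S T : finType) (e : S -> T -> bool) :
  (forall x y, e x y) -> giso (bip_graph e) (Kgraph #|S| #|T|).
Proof.
move=> eT; apply: (giso_bip_graph (enum_rank_bij S) (enum_rank_bij T)) => x y.
by rewrite eT.
Qed.

(** When all missing pairs lie in the column of [y0], the vertex [y0] plays the part of Y_2 and its
    non-neighbours that of X_2. *)
Lemma giso_Dgraph (S T : finType) (e : S -> T -> bool) (y0 : T) p1 p2 :
  #|S| = (p1 + p2)%N -> #|[set x | ~~ e x y0]| = p2 ->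
  (forall x y, y != y0 -> e x y) ->
  giso (bip_graph e) (Dgraph p1 p2 (#|T| - 1) 1).
Proof.
move=> Sp ep eT.
have [f [fB fP]] := bij_sum_of_pred ep Sp.
have T1 : #|T| = (#|T| - 1 + 1)%N by rewrite subnK//; apply/card_gt0P; exists y0.
have y01 : #|[set y | y == y0]| = 1 by rewrite cardsE card1.
have [g [gB gP]] := bij_sum_of_pred y01 T1.
apply: (giso_bip_graph fB gB) => x y; move: (fP x) (gP y).
case: (f x) (g y) => [i|i] [j|j] /=.
- by move=> _ /negbT /eT->.
- by move=> h /eqP->; rewrite -[RHS]negbK h.
- by move=> _ /negbT /eT->.
- by move=> h /eqP->; rewrite -[RHS]negbK h.
Qed.

Lemma giso_rho_le (R : realType) G H : giso G H -> (rho R G <= rho R H)%R.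
Proof.
move=> [f [g fK gK] fadj]; have [G0|G0] := posnP #|G|.
  by rewrite rho_void// rho_ge0.
have [w [_ [u wu] Aw]] := perron R G0.
rewrite -[leLHS]ger0_norm ?rho_ge0//.
apply: (@rho_ge _ _ _ (w \o g) (f u)); first by rewrite /= fK.
move=> v; rewrite /= -Aw (reindex f); last by exists g => x _; rewrite ?fK ?gK.
by apply: eq_bigr => x _; rewrite /= fK -{1}(gK v) fadj.
Qed.

Lemma giso_rho (R : realType) G H : giso G H -> rho R G = rho R H.
Proof. by move=> GH; apply/le_anti; rewrite !giso_rho_le//; exact: giso_sym. Qed.

(** * Existence of factors *)

(** The arithmetic behind [balanced_ldeg_le]: [u], [u'] and [t] stand for the sizes of [U], its
    complement and [V] there, and [K] for the number of missing pairs. *)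
Lemma overfull_counting u u' t m n a b K : 0 < b -> 0 < u -> u + u' = m ->
  t <= n -> a + K <= m -> m <= n -> a * n <= b * m ->
  b * u + 1 <= t * a -> t * u' + b * u + 1 <= t * a + K -> False.
Proof.
move=> b0 u0 um tn aK mn anbm uta h.
have t0 : 0 < t by lia.
have u'0 : 0 < u' by nia.
(* If [a <= u'], the last hypothesis together with [0 < t] and [K <= m - a] leaves
   [b * u + 1 <= u]. *)
have [au'|u'a] := leqP a u'; first by nia.
have [q aE] : exists q, a = u' + q by exists (a - u'); lia.
have [c uE] : exists c, u = q + c by exists (u - q); lia.
have K1 : K <= c by lia.
have h1 : b * u + 1 <= n * q + c by nia.
have h2 : a * n * u <= b * m * u by rewrite leq_mul2r anbm orbT.
have h3 : m * (b * u + 1) <= m * (n * q + c) by rewrite leq_mul2l h1 orbT.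
have h4 : m * c <= n * u' * c by rewrite leq_mul2r; nia.
have mE : m = u' + q + c by lia.
(* This is [a * u = u' * c + m * q] times [n]. With [h2] and [h3] it leaves
   [n * u' * c + m <= m * c], against [h4]. *)
have E1 : a * n * u = n * (u' * c) + m * (n * q) by rewrite mE aE uE; ring.
by nia.
Qed.

(** The arithmetic behind [balanced_ldeg_ge], with [u], [t] and [t'] the sizes of [U], [V] and the
    complement of [V] there. *)
Lemma underfull_counting u t t' m n a K : 0 < a -> 0 < u -> t + t' = n ->
  u <= m -> a + K <= m -> m <= n ->
  t * a + 1 <= a * u -> t' * u + t * a + 1 <= a * u + K -> False.
Proof.
move=> a0 u0 tn um aK mn tau h.
have t'0 : 0 < t' by nia.
have [at'|t'a] := leqP a t'; first by nia.
have [q aE] : exists q, a = t' + q by exists (a - t'); lia.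
have [c mE] : exists c, m = a + c by exists (m - a); lia.
have h1 : t * a + 1 <= q * m + c.
  have : a * u = t' * u + q * u by rewrite aE mulnDl.
  by have : q * u <= q * m; [rewrite leq_mul2l um orbT|lia].
have [d nE] : exists d, n = m + d by exists (n - m); lia.
have tE : t = q + c + d by lia.
(* With [h1] this leaves [t' * c + d * a + 1 <= c], which [0 < t'] forbids. *)
have E : t * a = q * m + t' * c + d * a by rewrite tE mE aE; ring.
by nia.
Qed.

(** * Subgraphs with right degrees [a] and balanced left degrees *)

Section BalancedSubgraph.
Variables (S T : finType) (e : S -> T -> bool) (a : nat).
Implicit Types (F : {set S * T}) (x : S) (y : T).

Definition missing := \sum_x \sum_y ~~ e x y.
Definition ldeg F x := \sum_y ((x, y) \in F).
Definition rdeg F y := \sum_x ((x, y) \in F).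
Definition right_regular F :=
  (forall x y, (x, y) \in F -> e x y) /\ (forall y, rdeg F y = a).
(** Replacing [(x, y)] by [(x', y)] in [F] keeps all right degrees and moves one unit of left degree
    from [x] to [x']. *)
Definition alt_step F : rel S := fun x x' =>
  [exists y, [&& (x, y) \in F, e x' y & (x', y) \notin F]].

Lemma missing_le_rdeg y : #|S| <= \sum_x e x y + missing.
Proof.
have h : \sum_x ~~ e x y <= missing.
  by apply: leq_sum => x _; rewrite (bigD1 y)//= leq_addr.
apply: leq_trans (leq_add (leqnn _) h); rewrite -big_split/= -sum1_card.
by apply: leq_sum => x _; case: (e x y).
Qed.

Lemma right_regular_exists : a + missing <= #|S| -> exists F, right_regular F.
Proof.
move=> aS.
have /choice[f fP] y : exists A : {set S}, A \subset [set x | e x y] /\ #|A| = a.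
  have : a <= #|[set x | e x y]|.
    have := missing_le_rdeg y; suff -> : \sum_x e x y = #|[set x | e x y]| by lia.
    by rewrite -sum1dep_card [RHS]big_mkcond; apply: eq_bigr => x _; case: (e x y).
  case/card_geqP => s [us <- sA]; exists [set x in s]; split.
    by apply/fintype.subsetP => x; rewrite inE => /sA.
  by rewrite cardsE; exact/card_uniqP.
exists [set p | p.1 \in f p.2]; split=> [x y|y].
  by rewrite inE/= => /(fintype.subsetP (fP y).1); rewrite inE.
rewrite -(fP y).2 -sum1_card [RHS]big_mkcond/=.
by apply: eq_bigr => x _; rewrite inE /=; case: (x \in f y).
Qed.

(* Along a repetition-free alternating path, exchanging the first pair of edges
   keeps the rest of the path alternating. *)
Lemma alt_path_shift F x p : right_regular F -> path (alt_step F) x p ->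
  uniq (x :: p) -> last x p != x ->
  exists F', right_regular F' /\
    forall z, ldeg F' z + (z == x) = ldeg F z + (z == last x p).
Proof.
elim: p F x => [|x1 p IH] F x rF /=; first by rewrite eqxx.
case/andP => /existsP[y /and3P[xyF e1 x1yF]] pth /andP[xp /andP[x1p up]] _.
have xx1 : x != x1 by apply: contraNneq xp => ->; rewrite inE eqxx.
pose F1 := (x1, y) |: (F :\ (x, y)).
have F1E z w : ((z, w) \in F1) = (z == x1) && (w == y) ||
    ~~ ((z == x) && (w == y)) && ((z, w) \in F).
  by rewrite !inE !xpair_eqE.
have F1l z : ldeg F1 z + (z == x) = ldeg F z + (z == x1).
  rewrite /ldeg (bigD1 y)//= [in RHS](bigD1 y)//= F1E eqxx !andbT.
  rewrite (eq_bigr (fun w => nat_of_bool ((z, w) \in F))); last first.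
    by move=> w wy; rewrite F1E (negPf wy) !andbF.
  move: (\sum_(w | w != y) _) => s.
  case: (eqVneq z x1) => [->|zx1] /=.
    by rewrite (negPf x1yF) eq_sym (negPf xx1)/=; lia.
  by case: (eqVneq z x) => [->|zx] /=; rewrite ?xyF ?addn0//= add0n addnC.
have rF1 : right_regular F1.
  split=> [z w|w].
    by rewrite F1E => /orP[/andP[/eqP-> /eqP->]//|/andP[_ /(rF.1)]].
  rewrite -(rF.2 w) /rdeg; have [->|wy] := eqVneq w y; last first.
    by apply: eq_bigr => z _; rewrite F1E (negPf wy) !andbF.
  rewrite (bigD1 x1)//= (bigD1 x)//= [in RHS](bigD1 x1)//=.
  rewrite [in RHS](bigD1 x)//= !F1E !eqxx/= xyF (negPf xx1) (negPf x1yF)/=.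
  rewrite !add0n; congr (_ + _); apply: eq_bigr => z /andP[zx1 zx].
  by rewrite F1E (negPf zx) (negPf zx1).
have pth1 : path (alt_step F1) x1 p.
  apply/(pathP x1) => i ip; have /(pathP x1)/(_ i ip) := pth.
  case/existsP => w /and3P[uw ev vw]; apply/existsP; exists w.
  have ux : nth x1 (x1 :: p) i != x.
    by apply: contraNneq xp => <-; rewrite mem_nth// ltnW.
  have vx1 : nth x1 p i != x1 by apply: contraNneq x1p => <-; rewrite mem_nth.
  by rewrite !F1E ev uw (negPf ux) (negPf vx1) (negPf vw)/= andbF orbT.
have [lx|lx] := eqVneq (last x1 p) x1.
  by exists F1; split=> // z; rewrite lx F1l.
have [F' [rF' F'l]] := IH F1 x1 rF1 pth1 (introT andP (conj x1p up)) lx.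
by exists F'; split=> // z; have := F'l z; have := F1l z; lia.
Qed.

(** Take [F] with the least sum of squared left degrees. Shifting a unit from degree [p] to degree
    [q] changes this sum by [2 * (q - p + 1)], which is negative once [p >= q + 2]. *)
Lemma balanced_exists : a + missing <= #|S| -> exists F, right_regular F /\
  forall x x', connect (alt_step F) x x' -> ldeg F x <= (ldeg F x').+1.
Proof.
move=> /right_regular_exists[F0 rF0].
pose Phi F := \sum_x ldeg F x ^ 2.
have [F] := @arg_minnP _ F0 (fun F => `[< right_regular F >]) Phi (asboolT rF0).
move=> /asboolP rF Fmin; exists F; split=> // x x'.
case/connectP => p0 pth0 ->; case/shortenP: pth0 => p pth up _ {p0 x'}.
have [->//|lx] := eqVneq (last x p) x.
rewrite leqNgt; apply/negP => lt.
have [F' [rF' F'l]] := alt_path_shift rF pth up lx.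
have := Fmin F' (asboolT rF'); rewrite /Phi leqNgt => /negP; apply.
rewrite (bigD1 x)//= (bigD1 (last x p))//= [ltnRHS](bigD1 x)//=.
rewrite [in ltnRHS](bigD1 (last x p))//=.
have -> : \sum_(z | (z != x) && (z != last x p)) ldeg F' z ^ 2 =
    \sum_(z | (z != x) && (z != last x p)) ldeg F z ^ 2.
  apply: eq_bigr => z /andP[zx zl]; have := F'l z.
  by rewrite (negPf zx) (negPf zl) !addn0 => ->.
have := F'l x; have := F'l (last x p); rewrite !eqxx (negPf lx) eq_sym (negPf lx).
rewrite !addn0 => El Ex; rewrite -!mulnn.
move: (\sum_(_ | _) _) lt El Ex => s.
by move: (ldeg F x) (ldeg F' x) (ldeg F (last x p)) (ldeg F' (last x p)) => /=; nia.
Qed.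

Variables (b : nat) (F : {set S * T}).
Hypotheses (a_gt0 : 0 < a) (le_ab : a <= b) (aS : a + missing <= #|S|)
  (le_ST : #|S| <= #|T|) (abST : a * #|T| <= b * #|S|).
Hypotheses (rF : right_regular F)
  (balF : forall x x', connect (alt_step F) x x' -> ldeg F x <= (ldeg F x').+1).

Lemma sum_missing_le (U : {set S}) (V : {set T}) :
  \sum_(x in U) \sum_(y in V) ~~ e x y <= missing.
Proof.
apply: (@leq_trans (\sum_(x in U) \sum_y ~~ e x y)).
  by apply: leq_sum => x _; rewrite [leqRHS](bigID (mem V))/= leq_addr.
by rewrite /missing [leqRHS](bigID (mem U))/= leq_addr.
Qed.

(** If [x] had degree above [b], every vertex of the set [U] reachable from [x] would have degree at
    least [b], too many edges for the set [V] of their [F]-neighbours. *)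
Lemma balanced_ldeg_le x : ldeg F x <= b.
Proof.
rewrite leqNgt; apply/negP => xb.
pose U := [set x' | connect (alt_step F) x x'].
pose V := [set y | [exists x' in U, (x', y) \in F]].
have xU : x \in U by rewrite inE connect0.
have U_ldeg : b * #|U| + 1 <= \sum_(x' in U) ldeg F x'.
  rewrite (bigD1 x)//= (cardD1 x) xU.
  suff : b * #|[predD1 U & x]| <= \sum_(i in U | i != x) ldeg F i by nia.
  rewrite mulnC -sum_nat_const; under eq_bigl do rewrite inE andbC.
  by apply: leq_sum => x' /andP[/[!inE] /balF]; lia.
have UV : \sum_(x' in U) ldeg F x' = \sum_(y in V) \sum_(x' in U) ((x', y) \in F).
  rewrite [RHS]exchange_big; apply: eq_bigr => x' x'U.
  rewrite /ldeg [LHS](bigID (mem V))/= [X in _ + X]big1 ?addn0// => y yV.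
  apply/eqP; rewrite eqb0; apply: contra yV => x'y.
  by rewrite inE; apply/exists_inP; exists x'.
(* An edge from [y] to a vertex outside [U] must lie in [F], since otherwise an alternating step
   would reach that vertex. *)
have V_out y : y \in V -> #|~: U| + \sum_(x' in U) ((x', y) \in F) <=
    a + \sum_(x' in ~: U) ~~ e x' y.
  rewrite inE => /exists_inP[z zU zy].
  rewrite -(rF.2 y) /rdeg [X in _ <= X + _](bigID (mem U))/= [leqLHS]addnC -addnA leq_add2l.
  rewrite [X in _ <= X + _](eq_bigl (fun x' => x' \in ~: U)); last first.
    by move=> x'; rewrite /= finset.in_setC.
  rewrite -big_split/= -sum1_card; apply: leq_sum => x' x'U.
  have [x'y|_] := boolP (e x' y); last by rewrite addn1.
  rewrite addn0 lt0b.
  apply: contraTT x'U => x'yF; rewrite !inE negbK.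
  move: zU; rewrite inE => /connect_trans; apply; apply: connect1.
  by apply/existsP; exists y; rewrite zy x'y.
have sumV : #|V| * #|~: U| + \sum_(x' in U) ldeg F x' <= #|V| * a + missing.
  have := leq_sum (index_enum T) V_out; rewrite !big_split/= !sum_nat_const -UV => h.
  apply: leq_trans h _; rewrite leq_add2l exchange_big/=; exact: sum_missing_le.
have sumVa : \sum_(x' in U) ldeg F x' <= #|V| * a.
  rewrite UV -sum_nat_const; apply: leq_sum => y _.
  by rewrite -(rF.2 y) /rdeg [leqRHS](bigID (mem U))/= leq_addr.
have U0 : 0 < #|U| by apply/card_gt0P; exists x.
apply: (@overfull_counting #|U| #|~: U| #|V| #|S| #|T| a b missing) => //.
- exact: leq_trans a_gt0 le_ab.
- exact: cardsC.
- by rewrite -[#|T|]cardsT subset_leq_card.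
- by lia.
- by lia.
Qed.

(** This mirrors the upper bound: [U] now collects the vertices that reach a vertex [x] of degree
    below [a], so their degrees are at most [a]. Columns in [V] have all their [F]-edges in [U]; in
    the other columns every edge from [U] is in [F]. *)
Lemma balanced_ldeg_ge x : a <= ldeg F x.
Proof.
rewrite leqNgt; apply/negP => xa.
pose U := [set x' | connect (alt_step F) x' x].
pose V := [set y | [exists x' in U, e x' y && ((x', y) \notin F)]].
have xU : x \in U by rewrite inE connect0.
have U_ldeg : \sum_(x' in U) ldeg F x' + 1 <= a * #|U|.
  rewrite (bigD1 x)//= (cardD1 x) xU.
  suff : \sum_(i in U | i != x) ldeg F i <= a * #|[predD1 U & x]| by nia.
  rewrite mulnC -sum_nat_const; under [leqRHS]eq_bigl do rewrite inE andbC.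
  by apply: leq_sum => x' /andP[/[!inE] /balF]; lia.
have V_in y : y \in V -> \sum_(x' in U) ((x', y) \in F) = a.
  rewrite inE => /exists_inP[z zU /andP[zy zyF]].
  rewrite -(rF.2 y) /rdeg [RHS](bigID (mem U))/= [X in _ + X]big1 ?addn0// => x' x'U.
  apply/eqP; rewrite eqb0; apply: contra x'U => x'y.
  move: zU; rewrite !inE; apply: connect_trans; apply: connect1.
  by apply/existsP; exists y; rewrite x'y zy.
have V_out y : y \in ~: V -> #|U| <= \sum_(x' in U) ((x', y) \in F) +
    \sum_(x' in U) ~~ e x' y.
  rewrite !inE => yV; rewrite -big_split/= -sum1_card; apply: leq_sum => x' x'U.
  have [x'y|_] := boolP (e x' y); last by rewrite addn1.
  rewrite addn0 lt0b; apply: contraNT yV => x'yF.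
  by apply/exists_inP; exists x' => //; rewrite x'y.
have sumV : #|~: V| * #|U| + #|V| * a <= \sum_(x' in U) ldeg F x' + missing.
  have -> : \sum_(x' in U) ldeg F x' =
      #|V| * a + \sum_(y in ~: V) \sum_(x' in U) ((x', y) \in F).
    rewrite /ldeg exchange_big (bigID (mem V))/= -sum_nat_const; congr (_ + _).
      exact: eq_bigr V_in.
    by apply: eq_bigl => y; rewrite finset.in_setC.
  have := leq_sum (index_enum T) V_out; rewrite !big_split/= !sum_nat_const => h.
  rewrite addnC -addnA leq_add2l (leq_trans h)// leq_add2l exchange_big/=.
  exact: sum_missing_le.
have sumVa : #|V| * a <= \sum_(x' in U) ldeg F x'.
  rewrite /ldeg exchange_big (bigID (mem V))/= -sum_nat_const.
  by rewrite -(eq_bigr _ V_in) leq_addr.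
have U0 : 0 < #|U| by apply/card_gt0P; exists x.
apply: (@underfull_counting #|U| #|V| #|~: V| #|S| #|T| a missing) => //.
- exact: cardsC.
- by rewrite -[#|S|]cardsT subset_leq_card.
- by lia.
- by lia.
Qed.

End BalancedSubgraph.

Lemma bip_graph_has_factor (S T : finType) (e : S -> T -> bool) a b :
  0 < a -> a <= b -> a + missing e <= #|S| -> #|S| <= #|T| ->
  a * #|T| <= b * #|S| -> has_factor a b (bip_graph e).
Proof.
move=> a0 ab aS ST abST.
have [F [rF balF]] := balanced_exists aS.
pose Fadj (u v : S + T) := match u, v with
  | inl x, inr y => (x, y) \in F
  | inr y, inl x => (x, y) \in F
  | _, _ => false end.
exists Fadj; split.
- by case=> [x|y] [x'|y'].
- by case=> [x|y] [x'|y'] //= /(rF.1).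
have degE u : #|[set v : bip_graph e | Fadj u v]| =
    match u with inl x => ldeg F x | inr y => rdeg F y end.
  rewrite -sum1dep_card big_mkcond big_sumType/=; case: u => [x|y] /=.
    by rewrite big1_eq add0n; apply: eq_bigr => y _; case: ifP.
  by rewrite [X in _ + X]big1_eq addn0; apply: eq_bigr => x _; case: ifP.
move=> u; rewrite degE; case: u => [x|y]; last by rewrite rF.2 leqnn.
by rewrite (balanced_ldeg_ge a0 ab aS ST abST rF balF) (balanced_ldeg_le a0 ab aS ST abST rF balF).
Qed.

(** * Nearly complete bipartite graphs *)

Local Open Scope ring_scope.

Section NearlyComplete.
Variables (R : realFieldType) (S T : finType) (e : S -> T -> bool).
Variables (r : R) (x : S -> R) (y : T -> R).
Hypothesis x_ge0 : forall i, 0 <= x i.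
Hypothesis xE : forall i, \sum_j (e i j)%:R * y j = r * x i.
Hypothesis yE : forall j, \sum_i (e i j)%:R * x i = r * y j.

Let m : R := #|S|%:R.
Let n : R := #|T|%:R.
Let K : R := (missing e)%:R.
Let c j : R := \sum_i (~~ e i j)%:R.
Let Sx : R := \sum_i x i.

Let eC i j : (e i j)%:R = 1 - (~~ e i j)%:R :> R.
Proof. by case: (e i j); rewrite ?subrr ?subr0. Qed.

Let sumc : \sum_j c j = K.
Proof.
rewrite /c exchange_big /K /missing natr_sum; apply: eq_bigr => i _.
by rewrite natr_sum.
Qed.

Let c_ge0 j : 0 <= c j. Proof. by apply: sumr_ge0 => i _. Qed.

Let c_ge i j : ~~ e i j -> 1 <= c j.
Proof.
by move=> eij; rewrite /c (bigD1 i)//= eij lerDl; apply: sumr_ge0 => k _.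
Qed.

Let c_leK j : c j <= K.
Proof. by rewrite -sumc (bigD1 j)//= lerDl; exact: sumr_ge0. Qed.

Let sum_e j : \sum_i (e i j)%:R = m - c j.
Proof.
under eq_bigr do rewrite eC; rewrite sumrB sumr_const /m.
by rewrite -[#|_|%:R]/(_ *+ _).
Qed.

Let c_lem j : c j <= m.
Proof. by rewrite -subr_ge0 -sum_e; apply: sumr_ge0. Qed.

Let sum_mc : \sum_j (m - c j) = m * n - K.
Proof. by rewrite sumrB sumr_const sumc mulr_natr. Qed.

Let x_sqr i : r ^+ 2 * x i = \sum_k x k * \sum_j (e i j)%:R * (e k j)%:R.
Proof.
rewrite expr2 -mulrA -xE mulr_sumr.
transitivity (\sum_j \sum_k (e i j)%:R * ((e k j)%:R * x k)).
  by apply: eq_bigr => j _; rewrite mulrCA -yE mulr_sumr.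
rewrite exchange_big; apply: eq_bigr => k _; rewrite mulr_sumr.
by apply: eq_bigr => j _; ring.
Qed.

Lemma sqr_rho_sum : r ^+ 2 * Sx =
  (m * n - K) * Sx - \sum_i \sum_j (~~ e i j)%:R * (m - c j) * x i.
Proof.
rewrite /Sx mulr_sumr (eq_bigr _ (fun i _ => x_sqr i)) exchange_big/=.
rewrite mulr_sumr -sumrB; apply: eq_bigr => k _.
rewrite -mulr_sumr exchange_big/= -sum_mc mulr_suml -sumrB mulr_sumr.
apply: eq_bigr => j _; rewrite -mulr_suml sum_e eC; ring.
Qed.

(** The number of common neighbours of [i] and [k], minus the lower bound used for it when [(i, j)]
    is missing. *)
Let gap i j k := \sum_l (e i l)%:R * (e k l)%:R - (n - 1 - (K - c j)).

(** Column [j] contributes no common neighbour, and the counts [c l] over the other columns add up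
    to [K - c j]. Each remaining term is nonnegative, because a column containing a missing pair has
    [c l >= 1]. *)
Let gapE i j k : ~~ e i j ->
  gap i j k = \sum_(l | l != j) ((e i l)%:R * (e k l)%:R - (1 - c l)).
Proof.
move=> eij; rewrite sumrB /gap [in LHS](bigD1 j)//= (negPf eij) mul0r add0r.
congr (_ - _); rewrite sumrB -sumc [in LHS](bigD1 j)//= [c j + _]addrC addrK.
congr (_ - _); rewrite /n -sum1_card natr_sum [in LHS](bigD1 j)//=.
by rewrite addrAC subrr add0r.
Qed.

Let gap_term i k l : 0 <= (e i l)%:R * (e k l)%:R - (1 - c l).
Proof.
have [ei|ei] := boolP (e i l); last by have := c_ge ei; rewrite mul0r; lra.
have [ek|ek] := boolP (e k l); last by have := c_ge ek; rewrite mulr0; lra.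
by have := c_ge0 l; rewrite mulr1 /=; lra.
Qed.

Let gap_ge0 i j k : ~~ e i j -> 0 <= gap i j k.
Proof. by move=> eij; rewrite gapE//; apply: sumr_ge0 => l _. Qed.

Let gap_gt0 i j k l : ~~ e i j -> l != j -> e i l -> e k l -> 0 < c l ->
  0 < gap i j k.
Proof.
move=> eij lj eil ekl cl; rewrite gapE// (bigD1 l)//= eil ekl.
by rewrite ltr_pwDl// ?sumr_ge0// mulr1 /=; lra.
Qed.

Let x_sqr_gap i j :
  r ^+ 2 * x i - (n - 1 - (K - c j)) * Sx = \sum_k x k * gap i j k.
Proof.
rewrite x_sqr /Sx mulr_sumr -sumrB; apply: eq_bigr => k _.
by rewrite /gap; ring.
Qed.

(** This is [(m - c j) * r ^+ 2 * x i - (m - K) * (n - 1) * Sx], split into two terms that are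
    nonnegative for a missing pair. The second uses [(m - c) * (n - 1 - (K - c)) - (m - K) * (n - 1)
    = (K - c) * (n - 1 - m + c)]. *)
Let t i j : R := (m - c j) * (\sum_k x k * gap i j k) +
  (K - c j) * (n - 1 - m + c j) * Sx.

Let quadE : (r ^+ 2 * (m * n - K - r ^+ 2) - K * (m - K) * (n - 1)) * Sx =
  \sum_i \sum_j (~~ e i j)%:R * t i j.
Proof.
have KE : K = \sum_i \sum_j (~~ e i j)%:R.
  by rewrite /K /missing natr_sum; apply: eq_bigr => i _; rewrite natr_sum.
have -> : (r ^+ 2 * (m * n - K - r ^+ 2) - K * (m - K) * (n - 1)) * Sx =
  r ^+ 2 * ((m * n - K) * Sx - r ^+ 2 * Sx) - K * ((m - K) * (n - 1) * Sx) by ring.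
rewrite sqr_rho_sum subKr.
rewrite mulr_sumr {1}KE mulr_suml -sumrB; apply: eq_bigr => i _.
rewrite mulr_sumr mulr_suml -sumrB; apply: eq_bigr => j _.
by rewrite /t -x_sqr_gap; ring.
Qed.

Hypothesis le_ST : (#|S| <= #|T|)%N.

Let mn : m <= n. Proof. by rewrite ler_nat. Qed.

Let Sx_ge0 : 0 <= Sx. Proof. exact: sumr_ge0. Qed.

Let sum_gap_ge0 i j : ~~ e i j -> 0 <= \sum_k x k * gap i j k.
Proof. by move=> eij; apply: sumr_ge0 => k _; rewrite mulr_ge0// gap_ge0. Qed.

Let t_ge0 i j : ~~ e i j -> 0 <= t i j.
Proof.
move=> eij; rewrite addr_ge0// ?mulr_ge0 ?sum_gap_ge0 ?subr_ge0 ?c_lem ?c_leK//.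
by have := c_ge eij; have := mn; lra.
Qed.

Let mut_ge0 i j : 0 <= (~~ e i j)%:R * t i j.
Proof. by case: (boolP (e i j)) => eij; rewrite ?mul0r ?mul1r ?t_ge0. Qed.

Hypothesis Sx_gt0 : 0 < Sx.

Lemma sqr_rho_le : r ^+ 2 <= m * n - K.
Proof.
rewrite -(ler_pM2r Sx_gt0) sqr_rho_sum gerBl; apply: sumr_ge0 => i _.
by apply: sumr_ge0 => j _; rewrite !mulr_ge0// subr_ge0.
Qed.

Lemma sqr_rho_quad : K * (m - K) * (n - 1) <= r ^+ 2 * (m * n - K - r ^+ 2).
Proof.
rewrite -subr_ge0 -(pmulr_lge0 _ Sx_gt0) quadE.
by apply: sumr_ge0 => i _; apply: sumr_ge0.
Qed.

Let c_eq1 i k j : c j = 1 -> ~~ e i j -> k != i -> e k j.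
Proof.
move=> cj eij ki; apply: contraT => ekj; have := cj.
rewrite /c (bigD1 i)//= (bigD1 k)//= eij ekj /=.
have : 0 <= \sum_(l | (l != i) && (l != k)) (~~ e l j)%:R :> R by apply: sumr_ge0.
by lra.
Qed.

(** By [quadE], equality makes [t i j] vanish at every missing pair, and then both of its summands
    vanish. *)
Lemma sqr_rho_quad_eq :
  r ^+ 2 * (m * n - K - r ^+ 2) = K * (m - K) * (n - 1) ->
  (0 < missing e)%N -> (missing e <= #|S|)%N ->
  (exists j0, forall i j, j != j0 -> e i j) \/
  (#|S| = #|T| /\ exists i0, forall i j, i != i0 -> e i j).
Proof.
move=> quad; rewrite -(ltr0n R) -(ler_nat R) -/K -/m => K0 Km.
have t0 i j : ~~ e i j -> t i j = 0.
  move=> eij; have /eqP := quadE.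
  rewrite quad subrr mul0r eq_sym psumr_eq0; last by move=> k _; apply: sumr_ge0.
  move=> /allP/(_ i (mem_index_enum i)); rewrite psumr_eq0//.
  move=> /allP/(_ j (mem_index_enum j)) /=.
  by rewrite eij mul1r => /eqP.
have [[i1 j1] eij1] : exists p : S * T, ~~ e p.1 p.2.
  apply/existsP; apply: contraTT K0 => /existsPn h.
  rewrite /K /missing big1 ?ltxx// => i _; rewrite big1// => j _.
  by have := h (i, j); rewrite negbK /= => ->.
rewrite /= in eij1.
have [[j0 cj0]|ncK] := pselect (exists j, c j = K).
  left; exists j0 => i j jj0; apply: contraT => eij.
  have := sumc; rewrite (bigD1 j0)//= (bigD1 j)//= cj0.
  have : 0 <= \sum_(l | (l != j0) && (l != j)) c l by apply: sumr_ge0.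
  by have := c_ge eij; lra.
right.
(* As no column holds all missing pairs, [c j < K]. The second summand then forces
   [n - 1 - m + c j = 0], where [m <= n] and [1 <= c j]. *)
have cP i j : ~~ e i j -> [/\ c j = 1, n = m & \sum_k x k * gap i j k = 0].
  move=> eij; have cK : c j < K.
    by rewrite lt_neqAle c_leK andbT; apply/eqP => h; apply: ncK; exists j.
  have c1 := c_ge eij.
  have /eqP := t0 i j eij; rewrite paddr_eq0 ?mulr_ge0 ?sum_gap_ge0 ?subr_ge0//; last first.
    by have := mn; lra.
  rewrite !mulf_eq0 (gt_eqF Sx_gt0) orbF => /andP[/orP g /orP h].
  have nm : n - 1 - m + c j = 0 by case: h => /eqP //; lra.
  have cj : c j = 1 by have := mn; lra.
  split=> //; first by have := mn; lra.
  by case: g => /eqP //; lra.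
split; first by apply/eqP; rewrite -(eqr_nat R) -/m -/n; have [_ -> _] := cP _ _ eij1.
(* Given missing pairs in distinct rows [i] and [i'], column [j'] makes [gap i j k] positive for
   each [k != i']. Using this in both orders kills all of [x], so the missing pairs share a row. *)
have x0 i j i' j' k : ~~ e i j -> ~~ e i' j' -> i' != i -> k != i' -> x k = 0.
  move=> eij eij' ii ki.
  have [cj' _ _] := cP _ _ eij'; have [cj _ /eqP] := cP _ _ eij.
  rewrite psumr_eq0; last by move=> l _; rewrite mulr_ge0// gap_ge0.
  move=> /allP/(_ k (mem_index_enum k)); rewrite /= mulf_eq0 => /orP[/eqP//|].
  rewrite gt_eqF//; apply: (@gap_gt0 _ _ _ j') => //.
  - by apply: contraNneq eij' => ->; apply: (c_eq1 cj eij ii).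
  - by apply: (c_eq1 cj' eij'); rewrite eq_sym.
  - exact: (c_eq1 cj' eij').
  - by rewrite cj'.
exists i1 => i j ii1; apply: contraT => eij.
suff : Sx = 0 by have := Sx_gt0; lra.
apply: big1 => k _; have [->|ki] := eqVneq k i.
  by apply: (x0 i j i1 j1); rewrite // eq_sym.
exact: (x0 i1 j1 i j).
Qed.

End NearlyComplete.

(** * The quadratic of the extremal graph and its dependence on the number of missing pairs *)

Section LargestRoot.
Variables (R : rcfType) (m n k : R).
Hypotheses (mn : m <= n) (k1 : 1 <= k) (km : k <= m).

(** The larger root [z] of [z * (m * n - k - z) = k * (m - k) * (n - 1)]. *)
Definition quad_root : R :=
  (m * n - k + Num.sqrt ((m * n - k) ^+ 2 - 4 * (k * (m - k) * (n - 1)))) / 2.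

Let m1 : 1 <= m. Proof. exact: le_trans km. Qed.
Let n1 : 1 <= n. Proof. exact: le_trans mn. Qed.

Let disc_ge : (2 * (m * (n - 1)) - (m * n - k)) ^+ 2 <=
  (m * n - k) ^+ 2 - 4 * (k * (m - k) * (n - 1)).
Proof.
rewrite -subr_ge0.
have -> : (m * n - k) ^+ 2 - 4 * (k * (m - k) * (n - 1)) -
  (2 * (m * (n - 1)) - (m * n - k)) ^+ 2 = 4 * ((n - 1) * (m - k) ^+ 2) by ring.
by rewrite !mulr_ge0 ?sqr_ge0 ?subr_ge0.
Qed.

(** The bound [m * (n - 1)] is the squared spectral radius of the complete bipartite subgraph
    obtained by deleting Y_2. *)
Lemma quad_root_ge : m * (n - 1) <= quad_root.
Proof.
have := disc_ge; rewrite -ler_sqrt ?(le_trans _ disc_ge) ?sqr_ge0// sqrtr_sqr.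
by move=> /(le_trans (ler_norm _)); rewrite /quad_root; lra.
Qed.

Lemma quad_rootP : quad_root * (m * n - k - quad_root) = k * (m - k) * (n - 1).
Proof.
rewrite /quad_root; set d := _ - 4 * _.
have dE : Num.sqrt d ^+ 2 = d by rewrite sqr_sqrtr// (le_trans _ disc_ge) ?sqr_ge0.
have -> : (m * n - k + Num.sqrt d) / 2 * (m * n - k - (m * n - k + Num.sqrt d) / 2) =
  ((m * n - k) ^+ 2 - Num.sqrt d ^+ 2) / 4 by field.
by rewrite dE /d; field.
Qed.

Lemma quad_root_max l : k * (m - k) * (n - 1) <= l * (m * n - k - l) -> l <= quad_root.
Proof.
move=> h; have : (2 * l - (m * n - k)) ^+ 2 <=
    (m * n - k) ^+ 2 - 4 * (k * (m - k) * (n - 1)).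
  have -> : (2 * l - (m * n - k)) ^+ 2 = (m * n - k) ^+ 2 - 4 * (l * (m * n - k - l)).
    by ring.
  by lra.
rewrite -ler_sqrt ?(le_trans _ disc_ge) ?sqr_ge0// sqrtr_sqr.
by move=> /(le_trans (ler_norm _)); rewrite /quad_root; lra.
Qed.

Variables (K l : R).
Hypotheses (kK : k <= K) (lK : l <= m * n - K)
  (quadK : K * (m - K) * (n - 1) <= l * (m * n - K - l)).

Let quadD : l * (m * n - k - l) - k * (m - k) * (n - 1) =
  l * (m * n - K - l) - K * (m - K) * (n - 1) +
  (K - k) * (l - m * (n - 1) + (n - 1) * ((m - K) + (m - k))).
Proof. by ring. Qed.

(** A value [l] above the root exceeds [m * (n - 1)], so [l <= m * n - K] gives [K <= m]. Then every
    factor in [quadD] is nonnegative and [l] satisfies the inequality for [k] too. *)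
Lemma quad_root_mono : l <= quad_root.
Proof.
rewrite leNgt; apply/negP => lt; have := quad_root_ge => ge.
have Km : K <= m by move: lK ge; rewrite mulrBr mulr1; lra.
suff : l <= quad_root by rewrite leNgt lt.
apply: quad_root_max; rewrite -subr_ge0 quadD addr_ge0 ?subr_ge0//.
rewrite mulr_ge0 ?subr_ge0//; apply: addr_ge0.
  by rewrite subr_ge0 (le_trans ge) ?ltW.
by rewrite mulr_ge0 ?subr_ge0// addr_ge0 ?subr_ge0.
Qed.

Lemma quad_root_mono_eq : 1 < n -> quad_root <= l ->
  K = k /\ l * (m * n - K - l) = K * (m - K) * (n - 1).
Proof.
move=> n_gt1 gel; have lE : l = quad_root by apply/le_anti; rewrite quad_root_mono.
have ge := quad_root_ge; have Km : K <= m by move: lK ge; rewrite mulrBr mulr1; lra.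
have KE : K = k.
  apply/le_anti; rewrite kK andbT leNgt; apply/negP => ltkK.
  (* Strictness comes from [(n - 1) * (m - k)], where [1 < n] and [k < K <= m]. *)
  have : 0 < (K - k) * (l - m * (n - 1) + (n - 1) * ((m - K) + (m - k))).
    rewrite mulr_gt0 ?subr_gt0// ltr_wpDl ?subr_ge0 ?lE// mulr_gt0 ?subr_gt0//.
    by rewrite ltr_wpDl ?subr_ge0// subr_gt0 (lt_le_trans ltkK).
  have := quad_rootP; rewrite -lE => lP pos; have /eqP := quadD.
  by rewrite lP subrr eq_sym gt_eqF// ltr_wpDl ?subr_ge0.
by split=> //; rewrite KE lE; exact: quad_rootP.
Qed.

End LargestRoot.

(** * Spectral radii of bipartite graphs, with eigenvectors split along the parts *)

Section BipartiteRho.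
Variables (R : realType) (S T : finType) (e : S -> T -> bool).

(** If [x] vanished, the second family of equations and [0 < rho] would make [y] vanish as well. *)
Lemma bip_graph_perron : 0 < rho R (bip_graph e) -> exists (x : S -> R) (y : T -> R),
  [/\ forall i, 0 <= x i,
      forall i, \sum_j (e i j)%:R * y j = rho R (bip_graph e) * x i,
      forall j, \sum_i (e i j)%:R * x i = rho R (bip_graph e) * y j &
      0 < \sum_i x i].
Proof.
move=> r0; have [G0|G0] := posnP #|bip_graph e|.
  by move: r0; rewrite rho_void// ltxx.
have [w [w0 [u wu] wE]] := perron R G0.
exists (w \o inl), (w \o inr).
have xE i : \sum_j (e i j)%:R * w (inr j) = rho R (bip_graph e) * w (inl i).
  rewrite -wE big_sumType/= [X in X + _]big1 ?add0r// => k _; exact: mul0r.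
have yE j : \sum_i (e i j)%:R * w (inl i) = rho R (bip_graph e) * w (inr j).
  rewrite -wE big_sumType/= [X in _ + X]big1 ?addr0// => k _; exact: mul0r.
split=> //=.
rewrite lt0r sumr_ge0// andbT; apply/eqP => Sx0.
have x0 i : w (inl i) = 0.
  move/eqP: Sx0; rewrite psumr_eq0// => /allP/(_ i (mem_index_enum i)) /=.
  by move=> /eqP.
case: u wu => [i|j]; first by rewrite x0 eqxx.
have /eqP := yE j; rewrite big1 => [|i _]; last by rewrite x0 mulr0.
by rewrite eq_sym mulf_eq0 (gt_eqF r0)/= => /eqP->; rewrite eqxx.
Qed.

Lemma bip_graph_rho_ge (r : R) (x : S -> R) (y : T -> R) :
  0 <= r -> (exists i, x i != 0) ->
  (forall i, \sum_j (e i j)%:R * y j = r * x i) ->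
  (forall j, \sum_i (e i j)%:R * x i = r * y j) -> r <= rho R (bip_graph e).
Proof.
move=> r0 [i xi] xE yE; rewrite -[leLHS]ger0_norm//.
pose w (u : S + T) : R := match u with inl i => x i | inr j => y j end.
apply: (@rho_ge R (bip_graph e) r w (inl i)) => //.
move=> [k|k]; rewrite big_sumType/=.
  by rewrite -xE [X in X + _]big1 ?add0r// => l _; rewrite mul0r.
by rewrite -yE [X in _ + X]big1 ?addr0// => l _; rewrite mul0r.
Qed.

Lemma bip_graph_rho_le : rho R (bip_graph e) <= Num.sqrt (#|S|%:R * #|T|%:R).
Proof.
have [r0|r0] := leP (rho R (bip_graph e)) 0; first exact: le_trans r0 (sqrtr_ge0 _).
have [x [y [x0 xE yE Sx]]] := bip_graph_perron r0.
have h : rho R (bip_graph e) ^+ 2 <= #|S|%:R * #|T|%:R.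
  by rewrite (le_trans (sqr_rho_le x0 xE yE Sx))// gerBl.
by rewrite -[leLHS]ger0_norm ?rho_ge0// -sqrtr_sqr ler_wsqrtr.
Qed.

Lemma bip_graph_rho_eq : rho R (bip_graph e) = Num.sqrt (#|S|%:R * #|T|%:R) ->
  forall i j, e i j.
Proof.
move=> rE i j.
have ST0 : 0 < #|S|%:R * #|T|%:R :> R.
  by rewrite mulr_gt0// ltr0n; apply/card_gt0P; [exists i|exists j].
have r0 : 0 < rho R (bip_graph e) by rewrite rE sqrtr_gt0.
have [x [y [x0 xE yE Sx]]] := bip_graph_perron r0.
have := sqr_rho_le x0 xE yE Sx; rewrite rE (sqr_sqrtr (ltW ST0)) -subr_ge0 addrAC subrr add0r.
rewrite oppr_ge0 lern0 /missing sum_nat_eq0 => /forallP/(_ i).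
by rewrite implyTb sum_nat_eq0 => /forallP/(_ j); rewrite implyTb eqb0 negbK.
Qed.

End BipartiteRho.

Lemma Kgraph_rho (R : realType) m n : rho R (Kgraph m n) = Num.sqrt (m%:R * n%:R).
Proof.
apply/le_anti/andP; split.
  by have := @bip_graph_rho_le R 'I_m 'I_n (fun _ _ => true); rewrite !card_ord.
case: m => [|m]; first by rewrite mul0r sqrtr0 rho_ge0.
set r := Num.sqrt _; have rr : r * r = m.+1%:R * n%:R.
  by rewrite -expr2 sqr_sqrtr// mulr_ge0.
(* For [r = 0] the vector chosen below would vanish on the left part. *)
have [->|r0] := eqVneq r 0; first exact: rho_ge0.
apply: (@bip_graph_rho_ge _ _ _ _ r (fun=> r) (fun=> m.+1%:R)); first exact: sqrtr_ge0.
- by exists ord0.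
- by move=> i; rewrite mul1r sumr_const card_ord rr mulr_natr.
- by move=> j; rewrite mul1r sumr_const card_ord mulr_natr.
Qed.

(** The eigenvector is constant on each of the four cells. The hypothesis on [l] is the quadratic of
    [quad_root] with [m = p1 + p2], [n = q + 1] and [k = p2]. *)
Lemma Dgraph_rho_ge (R : realType) p1 p2 q (l : R) : (0 < p2)%N -> 0 <= l ->
  l * (p1%:R + (p1%:R + p2%:R) * q%:R - l) = p1%:R * p2%:R * q%:R ->
  Num.sqrt l <= rho R (Dgraph p1 p2 q 1).
Proof.
move=> p20 l0 lE.
have lE' : q%:R * (p1%:R * l + p2%:R * (l - p1%:R)) = l * (l - p1%:R).
  transitivity (l * (l - p1%:R) +
    (l * (p1%:R + (p1%:R + p2%:R) * q%:R - l) - p1%:R * p2%:R * q%:R)).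
    by ring.
  by rewrite lE subrr addr0.
have [->|ln0] := eqVneq l 0; first by rewrite sqrtr0 rho_ge0.
set r := Num.sqrt l; have rr : r * r = l by rewrite -expr2 sqr_sqrtr.
have r0 : r != 0 by rewrite sqrtr_eq0 -ltNge lt0r ln0.
pose x (u : 'I_p1 + 'I_p2) := if u is inl _ then r * l else r * (l - p1%:R).
pose y (u : 'I_q + 'I_1) : R :=
  if u is inl _ then p1%:R * l + p2%:R * (l - p1%:R) else p1%:R * l.
apply: (@bip_graph_rho_ge _ _ _ _ r x y); first exact: sqrtr_ge0.
(* The value on X_2 may be 0 when [l = p1], so X_1 supplies the nonzero entry unless it is empty. *)
- have [p10|/(fun h => Ordinal h) i] := posnP p1; last by exists (inl i); rewrite mulf_neq0.
  by exists (inr (Ordinal p20)); rewrite /x p10 subr0 mulf_neq0.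
- case=> i; rewrite big_sumType/= sumr_const big_ord1 card_ord; last first.
    by rewrite !mul1r mul0r addr0 -[LHS]mulr_natl lE' mulrA rr.
  by rewrite !mul1r -[X in X + _]mulr_natl lE' mulrA rr; ring.
- case=> j; rewrite big_sumType/= !sumr_const !card_ord ?mul1r ?mul0r ?mul0rn;
    rewrite -?[X in _ + X]mulr_natl -[X in X + _]mulr_natl; ring.
Qed.

Lemma missing_column (S T : finType) (e : S -> T -> bool) (j0 : T) :
  (forall i j, j != j0 -> e i j) -> missing e = #|[set i | ~~ e i j0]|.
Proof.
move=> ej; rewrite /missing -sum1dep_card [RHS]big_mkcond; apply: eq_bigr => i _.
rewrite (bigD1 j0)//= big1 ?addn0 => [|j jj0]; last by rewrite ej.
by case: (e i j0).
Qed.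

Lemma missing_swap (S T : finType) (e : S -> T -> bool) :
  missing (fun y x => e x y) = missing e.
Proof. by rewrite /missing exchange_big. Qed.

(** * Comparison with the extremal graph *)

Section NearlyCompleteBound.
Variables (R : realType) (S T : finType) (e : S -> T -> bool) (p k : nat).
Hypotheses (Sk : #|S| = (p + k)%N) (k_gt0 : (0 < k)%N) (le_ST : (#|S| <= #|T|)%N)
  (k_missing : (k <= missing e)%N).

Let m : R := #|S|%:R.
Let n : R := #|T|%:R.
Let D := Dgraph p k (#|T| - 1) 1.
Let mn : m <= n. Proof. by rewrite ler_nat. Qed.
Let k1 : 1 <= k%:R :> R. Proof. by rewrite ler1n. Qed.
Let km : k%:R <= m. Proof. by rewrite ler_nat Sk leq_addl. Qed.
Let T_gt0 : (0 < #|T|)%N. Proof. by rewrite (leq_trans _ le_ST)// Sk addn_gt0 k_gt0 orbT. Qed.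
Let quad_root_ge0 : 0 <= quad_root m n k%:R.
Proof.
by apply: le_trans (quad_root_ge mn k1 km); rewrite mulr_ge0// subr_ge0 ler1n.
Qed.

Lemma Dgraph_quad_root : Num.sqrt (quad_root m n k%:R) <= rho R D.
Proof.
apply: Dgraph_rho_ge => //; have := quad_rootP mn k1 km.
rewrite natrB// -natrD -Sk -/m -/n.
have -> : p%:R = m - k%:R by rewrite /m Sk natrD addrK.
by move=> h; rewrite [m - _ + _](_ : _ = m * n - k%:R) ?h; ring.
Qed.

Let rho_sqr_le : 0 < rho R (bip_graph e) ->
  rho R (bip_graph e) ^+ 2 <= quad_root m n k%:R.
Proof.
move=> r0; have [x [y [x0 xE yE Sx]]] := bip_graph_perron r0.
apply: (@quad_root_mono _ _ _ _ mn k1 km (missing e)%:R); first by rewrite ler_nat.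
  exact: (sqr_rho_le x0 xE yE Sx).
exact: (sqr_rho_quad x0 xE yE le_ST Sx).
Qed.

Lemma rho_le_Dgraph : rho R (bip_graph e) <= rho R D.
Proof.
have [r0|r0] := leP (rho R (bip_graph e)) 0; first exact: le_trans r0 (rho_ge0 _ _).
apply: le_trans Dgraph_quad_root.
by rewrite -[leLHS]ger0_norm ?rho_ge0// -sqrtr_sqr ler_wsqrtr// rho_sqr_le.
Qed.

Lemma rho_eq_Dgraph : rho R (bip_graph e) = rho R D -> giso (bip_graph e) D.
Proof.
move=> rE.
(* With one right vertex the size hypotheses force [#|S| = k = 1], and the only pair is missing. *)
have [T1|T1] := leqP #|T| 1.
  have [j0 _] := card_gt0P T_gt0.
  have ej i j : j != j0 -> e i j.
    by have /fintype_le1P/(_ j0 j)/= -> := T1; rewrite eqxx.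
  have := missing_column ej; have := max_card [set i | ~~ e i j0] => h1 h2.
  by apply: (@giso_Dgraph _ _ _ j0) => //; lia.
have n1 : 1 < n by rewrite ltr1n.
have q0 : 0 < quad_root m n k%:R.
  apply: lt_le_trans (quad_root_ge mn k1 km).
  by rewrite mulr_gt0 ?subr_gt0// ltr0n Sk addn_gt0 k_gt0 orbT.
have r0 : 0 < rho R (bip_graph e).
  by rewrite rE (lt_le_trans _ Dgraph_quad_root)// sqrtr_gt0.
have ger : quad_root m n k%:R <= rho R (bip_graph e) ^+ 2.
  rewrite -(sqr_sqrtr (ltW q0)) lerXn2r ?nnegrE ?sqrtr_ge0 ?rho_ge0//.
  by rewrite rE Dgraph_quad_root.
have [x [y [x0 xE yE Sx]]] := bip_graph_perron r0.
have kK : k%:R <= (missing e)%:R :> R by rewrite ler_nat.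
have [Kk quad] := quad_root_mono_eq mn k1 km kK (sqr_rho_le x0 xE yE Sx)
  (sqr_rho_quad x0 xE yE le_ST Sx) n1 ger.
have {}Kk : missing e = k by apply/eqP; rewrite -(eqr_nat R); exact/eqP.
have K0 : (0 < missing e)%N by rewrite Kk.
have KS : (missing e <= #|S|)%N by rewrite Kk Sk leq_addl.
have [[j0 ej]|[ST [i0 ei]]] := sqr_rho_quad_eq x0 xE yE le_ST Sx quad K0 KS.
  by apply: (@giso_Dgraph _ _ _ j0) => //; rewrite -missing_column.
(* All missing pairs lie in one row and the parts have equal size, so exchanging the parts reduces
   to the column case. *)
apply: giso_trans (giso_bip_graph_swap e) _.
rewrite /D -ST; apply: (@giso_Dgraph _ _ _ i0); first by rewrite -ST.
  by rewrite -Kk -missing_swap; apply/esym/missing_column => j i /ei.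
by move=> j i /ei.
Qed.

End NearlyCompleteBound.

Local Close Scope ring_scope.

Theorem theorem1p5 (R : realType) (a b : nat) (G : sgraph) (X Y : {set G})
    (a_gt0 : (0 < a)%N) (le_ab : (a <= b)%N)
    (bipG : bipartition X Y) (le_XY : (#|X| <= #|Y|)%N)
    (noF : ~ has_factor a b G) :
  [/\ (b * #|X| < a * #|Y|)%N ->
        (rho R G <= Num.sqrt (#|X|%:R * #|Y|%:R))%R /\
        (rho R G = Num.sqrt (#|X|%:R * #|Y|%:R)%R <->
         giso G (Kgraph #|X| #|Y|)),
      (a * #|Y| <= b * #|X|)%N -> (#|X| < a)%N ->
        (rho R G <= Num.sqrt (#|X|%:R * #|Y|%:R))%R /\
        (rho R G = Num.sqrt (#|X|%:R * #|Y|%:R)%R <->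
         giso G (Kgraph #|X| #|Y|)) &
      (a * #|Y| <= b * #|X|)%N -> (a <= #|X|)%N ->
        (rho R G <= rho R (Dgraph (a - 1) (#|X| - a + 1) (#|Y| - 1) 1))%R /\
        (rho R G = rho R (Dgraph (a - 1) (#|X| - a + 1) (#|Y| - 1) 1) <->
         giso G (Dgraph (a - 1) (#|X| - a + 1) (#|Y| - 1) 1))].
Proof.
have isoG := giso_bip_graph_sub bipG; have isoG' := giso_sym isoG.
move: isoG isoG'; set e := fun x y => adj _ _ => isoG isoG'.
have cX : #|{: {x : G | x \in X}}| = #|X| by rewrite card_sig; apply: eq_card.
have cY : #|{: {y : G | y \in Y}}| = #|Y| by rewrite card_sig; apply: eq_card.
(* Cases (i) and (ii) share this conclusion. *)
have bound : (rho R G <= Num.sqrt (#|X|%:R * #|Y|%:R))%R /\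
    (rho R G = Num.sqrt (#|X|%:R * #|Y|%:R)%R <-> giso G (Kgraph #|X| #|Y|)).
  rewrite -(giso_rho R isoG) -cX -cY; split; first exact: bip_graph_rho_le.
  split=> [/bip_graph_rho_eq eT|/(giso_rho R)].
    exact: giso_trans isoG' (giso_Kgraph eT).
  by rewrite -(giso_rho R isoG) Kgraph_rho.
split=> // abXY aX.
(* Otherwise [a + missing e <= #|X|], and a factor would exist. *)
have k_missing : #|X| - a + 1 <= missing e.
  rewrite leqNgt; apply/negP => h; apply/noF/(giso_has_factor isoG).
  by apply: bip_graph_has_factor; rewrite ?cX ?cY//; lia.
have Sk : #|{: {x : G | x \in X}}| = (a - 1) + (#|X| - a + 1) by rewrite cX; lia.
have k_gt0 : 0 < #|X| - a + 1 by rewrite addn1.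
have le_ST : #|{: {x : G | x \in X}}| <= #|{: {y : G | y \in Y}}| by rewrite cX cY.
have := rho_le_Dgraph R Sk k_gt0 le_ST k_missing.
have := @rho_eq_Dgraph R _ _ _ _ _ Sk k_gt0 le_ST k_missing.
rewrite (giso_rho R isoG) cY => eqD leD; split=> //; split=> [/eqD|/(giso_rho R)//].
exact: giso_trans.
Qed.
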